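(* Let $(\mathcal{M},g)$ be a Riemannian $n$-manifold with its Levi-Civita connection, $p_0\in\mathcal{M}$, let $\mu$ be a wrapped probability measure centered at $p_0$ with support $\mathcal{X}=\operatorname{supp}\mu$, and let $f:\mathcal{X}\to\mathbb{R}$ be sufficiently smooth, with Riemannian gradient $\nabla_{\mathcal{M}}f$. Let $$G_0=\int_{\mathcal{X}}\mathcal{P}_p[\nabla_{\mathcal{M}}f(p)]\otimes\mathcal{P}_p[\nabla_{\mathcal{M}}f(p)]\,d\mu(p)=W_0\Lambda_0W_0^{\top}$$ be represented in an orthonormal basis of $T_{p_0}\mathcal{M}$, with $W_0=[\boldsymbol{w}_1,\dots,\boldsymbol{w}_n]$ orthogonal and $\Lambda_0=\mathrm{diag}(\lambda_1,\dots,\lambda_n)$, $\lambda_1\ge\dots\ge\lambda_n$. Define $\boldsymbol{w}_i(p)=\mathcal{P}_p^{-1}[\boldsymbol{w}_i]\in T_p\mathcal{M}$ for $p\in\mathcal{X}$. Then for $i=1,\dots,n$, $$\lambda_i=\int_{\mathcal{X}}\big(df_p[\boldsymbol{w}_i(p)]\big)^2\,d\mu(p),$$ i.e. the eigenvalues of $G_0$ are the ordered mean-squared directional derivatives of $f$ along the transported eigenvector fields $\boldsymbol{w}_i(p)$.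
   Context: Wrapped measure: $\mu$ is the pushforward under the exponential map $\exp_{p_0}$ of a Borel probability measure on $T_{p_0}\mathcal{M}$ whose support is star-shaped and lies within the cut locus of $p_0$ (i.e. inside the region bounded by the tangent cut locus), so that each $p\in\mathcal{X}=\operatorname{supp}\mu$ is joined to $p_0$ by a unique (minimizing, radial) geodesic. $\mathcal{P}_p:T_p\mathcal{M}\to T_{p_0}\mathcal{M}$ denotes parallel transport along that unique geodesic from $p$ to $p_0$. The Riemannian gradient $\nabla_{\mathcal{M}}f(p)\in T_p\mathcal{M}$ is defined by $g_p(\nabla_{\mathcal{M}}f(p),\boldsymbol{v})=df_p[\boldsymbol{v}]$ for all $\boldsymbol{v}\in T_p\mathcal{M}$. ''Sufficiently smooth'' means that $f$ is $C^1$ on a neighborhood of $\mathcal{X}$, with gradient square-integrable with respect to $\mu$ (so $G_0$ is well defined). $T_{p_0}\mathcal{M}$ is identified with $\mathbb{R}^n$ through an orthonormal basis, so that $\boldsymbol{u}\otimes\boldsymbol{u}=\boldsymbol{u}\boldsymbol{u}^{\top}$, $G_0$ is a symmetric positive semidefinite $n\times n$ matrix, and its eigenvectors $\boldsymbol{w}_i$ are regarded as elements of $T_{p_0}\mathcal{M}$. *)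

(* Defs.v *)
From HB Require Import structures.
From mathcomp Require Import all_boot all_order all_algebra.
From mathcomp Require Import all_classical all_reals all_analysis.

Set Implicit Arguments.
Unset Strict Implicit.
Unset Printing Implicit Defensive.

Import Order.TTheory GRing.Theory Num.Theory.
Import numFieldNormedType.Exports.

Local Open Scope classical_set_scope.
Local Open Scope ring_scope.

Section Calculus.
Context {R : realType} {n : nat} {W : normedModType R}.

(* Only meaningful for open [A]: derivatives are unrestricted. *)
Fixpoint Ck_on (k : nat) (A : set 'rV[R]_n) (f : 'rV[R]_n -> W) : Prop :=
  if k is k'.+1 then
    (forall x, A x -> differentiable f x) /\
    (forall v, Ck_on k' A (fun x => 'd f x v))
  else forall x, A x -> {for x, continuous f}.

Definition smooth_on (A : set 'rV[R]_n) (f : 'rV[R]_n -> W) : Prop :=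
  forall k, Ck_on k A f.

End Calculus.

Section BorelMeasures.

Definition borel (T : ptopologicalType) := g_sigma_algebraType (@open T).

Definition measure_support (R : realType) (T : ptopologicalType)
    (mu : set (borel T) -> \bar R) : set T :=
  [set x | forall U : set T, open U -> U x -> (0 < mu U)%E].

End BorelMeasures.

Section Manifolds.
Context (R : realType) (n : nat) (M : ptopologicalType).
Local Notation E := 'rV[R]_n.

(* [cmap] and [cinv] are total functions; they carry information only on
   [cdom] and on its image. *)
Record chart := Chart {
  cdom : set M;
  cmap : M -> E;
  cinv : E -> M }.

Definition cimg (c : chart) : set E := cmap c @` cdom c.

Record chart_axioms (c : chart) : Prop := ChartAxioms {
  cdom_open : open (cdom c);
  cimg_open : open (cimg c);
  cmapK : forall p, cdom c p -> cinv c (cmap c p) = p;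
  cmap_continuous : forall p, cdom c p -> {for p, continuous (cmap c)};
  cinv_continuous : forall x, cimg c x -> {for x, continuous (cinv c)} }.

Definition transition (c d : chart) : E -> E := cmap d \o cinv c.

Definition overlap (c d : chart) : set E := cmap c @` (cdom c `&` cdom d).

(* The chart chosen at each point carries no geometric content: it only serves
   to represent tangent vectors. *)
Record smooth_manifold := SmoothManifold {
  atlas : set chart;
  chart_at : M -> chart;
  manifold_hausdorff : hausdorff_space M;
  manifold_second_countable : @second_countable M;
  atlas_chart : forall c, atlas c -> chart_axioms c;
  atlas_compatible : forall c d, atlas c -> atlas d ->
    smooth_on (overlap c d) (transition c d);
  chart_at_atlas : forall p, atlas (chart_at p);
  chart_at_dom : forall p, cdom (chart_at p) p }.

Variable S : smooth_manifold.

(* A tangent vector at [p] is represented by its components in the chart chosen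
   at [p]. All the types [tangent p] are thus convertible, but components of
   vectors at different points are never compared without a change of chart. *)
Definition tangent (p : M) : Type := E.

Definition coord (c : chart) (p : M) (v : tangent p) : E :=
  'd (transition (chart_at S p) c) (cmap (chart_at S p) p) v.

(* The coordinate vector field of [c] with index [i], at [p]. *)
Definition frame (c : chart) (p : M) (i : 'I_n) : tangent p :=
  'd (transition c (chart_at S p)) (cmap c p) (delta_mx ord0 i).

(* Metric components of [c], as functions on the image of [c]. *)
Definition gram (b : forall p, tangent p -> tangent p -> R)
    (c : chart) (i j : 'I_n) (x : E) : R :=
  b (cinv c x) (frame c (cinv c x) i) (frame c (cinv c x) j).

Record riemannian_metric := RiemannianMetric {
  inner : forall p, tangent p -> tangent p -> R;
  innerDZ : forall p (a : R) (u v w : E),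
    @inner p (a *: u + v) w = a * @inner p u w + @inner p v w;
  innerC : forall p (u v : tangent p), inner u v = inner v u;
  inner_gt0 : forall p (u : E), u != 0 -> 0 < @inner p u u;
  inner_smooth : forall c i j, atlas S c ->
    smooth_on (cimg c) (gram (@inner) c i j) }.

Variable g : riemannian_metric.

Definition pderive (i : 'I_n) (f : E -> R) (x : E) : R :=
  'd f x (delta_mx ord0 i).

(* [Gam c k i j] is the component along the [k]-th coordinate field of the
   covariant derivative of the [j]-th coordinate field along the [i]-th. *)
Definition christoffel_symbols := chart -> 'I_n -> 'I_n -> 'I_n -> E -> R.

(* An affine connection, given by its Christoffel symbols in every chart. *)
Definition is_connection (Gam : christoffel_symbols) : Prop :=
  (forall c k i j, atlas S c -> smooth_on (cimg c) (Gam c k i j)) /\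
  (forall c d, atlas S c -> atlas S d -> forall x, overlap c d x ->
    let tau a := fun y : E => transition c d y ord0 a in
    forall i j k,
      \sum_m Gam c m i j x * pderive m (tau k) x =
      pderive i (pderive j (tau k)) x +
      \sum_a \sum_b pderive i (tau a) x * pderive j (tau b) x
                    * Gam d k a b (transition c d x)).

Definition torsion_free (Gam : christoffel_symbols) : Prop :=
  forall c, atlas S c -> forall x, cimg c x ->
  forall i j k, Gam c k i j x = Gam c k j i x.

Definition metric_compatible (Gam : christoffel_symbols) : Prop :=
  forall c, atlas S c -> forall x, cimg c x -> forall i j k,
  pderive k (gram (@inner g) c i j) x =
    \sum_l (Gam c l k i x * gram (@inner g) c l j x + Gam c l k j x * gram (@inner g) c i l x).

Definition levi_civita (Gam : christoffel_symbols) : Prop :=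
  [/\ is_connection Gam, torsion_free Gam & metric_compatible Gam].

Definition velocity (gam : R -> M) (t : R) : tangent (gam t) :=
  derive1 (cmap (chart_at S (gam t)) \o gam) t.

Definition C1_curve (J : set R) (gam : R -> M) : Prop :=
  forall t, J t -> {for t, continuous gam} /\
  forall c, atlas S c -> cdom c (gam t) ->
    derivable (cmap c \o gam) t 1 /\ {for t, continuous (derive1 (cmap c \o gam))}.

Definition speed (gam : R -> M) (t : R) : R :=
  Num.sqrt (inner g (velocity gam t) (velocity gam t)).

Definition curve_length (gam : R -> M) (a b : R) : \bar R :=
  (\int[lebesgue_measure]_(t in `[a, b]) (speed gam t)%:E)%E.

(* Curves on [0, s] are restrictions of curves on a neighbourhood of [0, s]. *)
Definition around (s e : R) : set R := `]- e, s + e[.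

Definition riemannian_distance (p q : M) : \bar R :=
  ereal_inf [set l | exists sig : R -> M,
    [/\ exists2 e, 0 < e & C1_curve (around 1 e) sig,
        sig 0 = p, sig 1 = q & l = curve_length sig 0 1]].

Variable Gam : christoffel_symbols.

Definition parallel_along (J : set R) (gam : R -> M)
    (V : forall t, tangent (gam t)) : Prop :=
  forall t, J t -> forall c, atlas S c -> cdom c (gam t) ->
  let x := cmap c \o gam in
  let v := fun s => coord c (V s) in
  derivable v t 1 /\
  forall k, derive1 v t ord0 k =
    - \sum_i \sum_j Gam c k i j (x t) * derive1 x t ord0 i * v t ord0 j.

Definition geodesic (s : R) (gam : R -> M) : Prop :=
  exists e, [/\ 0 < e, C1_curve (around s e) gam &
    parallel_along (around s e) (velocity gam)].

Definition minimizing (s : R) (gam : R -> M) : Prop :=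
  curve_length gam 0 s = riemannian_distance (gam 0) (gam s).

Definition starts (p : M) (v : tangent p) (gam : R -> M) : Prop :=
  gam 0 = p /\ velocity gam 0 = v.

(* Total: the value is the junk point [p] where the exponential map is undefined. *)
Definition exp_map (p : M) (v : tangent p) : M :=
  xget p [set q | exists gam, [/\ geodesic 1 gam, starts v gam & gam 1 = q]].

(* The region of the tangent space bounded by the tangent cut locus: the
   geodesic with initial velocity [v] minimizes beyond time 1. *)
Definition injectivity_domain (p : M) : set E :=
  [set v | exists s gam, [/\ 1 < s, geodesic s gam, @starts p v gam &
                             minimizing s gam]].

Definition star_shaped (A : set E) : Prop :=
  forall v t, A v -> 0 <= t <= 1 -> A (t *: v).

Definition wrapped_measure (p0 : M) (mu : probability (borel M) R) : Prop :=
  exists nu : probability (borel E) R,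
  [/\ star_shaped (measure_support nu),
      measure_support nu `<=` injectivity_domain p0 &
      forall A : set (borel M), measurable A ->
        mu A = pushforward nu (@exp_map p0 : borel E -> borel M) A].

Definition minimizing_geodesic (p q : M) (gam : R -> M) : Prop :=
  [/\ geodesic 1 gam, minimizing 1 gam, gam 0 = p & gam 1 = q].

Definition unique_minimizing_geodesic (p q : M) (gam : R -> M) : Prop :=
  minimizing_geodesic p q gam /\
  forall sig, minimizing_geodesic p q sig ->
    forall t, 0 <= t <= 1 -> sig t = gam t.

(* [tau] is parallel transport along [gam], backwards from time 1 to time 0. *)
Definition is_transport_back (gam : R -> M)
    (tau : tangent (gam 1) -> tangent (gam 0)) : Prop :=
  forall v, exists V : forall t, tangent (gam t),
  [/\ exists2 e, 0 < e & parallel_along (around 1 e) V, V 1 = v & V 0 = tau v].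

(* [P p] is parallel transport from [p] to [p0] along the unique minimizing
   geodesic joining them; here [gam 1 = p] and [gam 0 = p0]. *)
Definition radial_transport (p0 : M) (X : set M)
    (P : forall p, tangent p -> tangent p0) : Prop :=
  forall p, X p -> exists2 gam, unique_minimizing_geodesic p0 p gam &
    @is_transport_back gam (P p).

Definition dform (f : M -> R) (p : M) (v : tangent p) : R :=
  'd (f \o cinv (chart_at S p)) (cmap (chart_at S p) p) v.

Definition gradient (f : M -> R) (p : M) : tangent p :=
  xget 0 [set u : E | forall v : E, @inner g p u v = @dform f p v].

Definition C1_near (X : set M) (f : M -> R) : Prop :=
  exists U : set M, [/\ open U, X `<=` U &
    forall c, atlas S c ->
      Ck_on 1 (cmap c @` (cdom c `&` U)) (f \o cinv c)].

Definition orthonormal_basis (p : M) (e : 'I_n -> tangent p) : Prop :=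
  forall i j, inner g (e i) (e j) = (i == j)%:R.

Definition basis_coord (p : M) (e : 'I_n -> tangent p) (u : tangent p) :
    'cV[R]_n := \col_i inner g u (e i).

Definition of_basis_coord (p : M) (e : 'I_n -> tangent p) (a : 'cV[R]_n) :
    tangent p := \sum_i a i ord0 *: (e i : E).

Definition transported_gradient (p0 : M) (e : 'I_n -> tangent p0)
    (P : forall p, tangent p -> tangent p0) (f : M -> R) (p : M) : 'cV[R]_n :=
  basis_coord e (P p (gradient f p)).

(* Measurability is part of square integrability: it is stated for the
   transported gradient, whose norm is that of the gradient. *)
Definition square_integrable_gradient (p0 : M) (e : 'I_n -> tangent p0)
    (P : forall p, tangent p -> tangent p0) (mu : probability (borel M) R)
    (X : set M) (f : M -> R) : Prop :=
  (forall i, measurable_fun (X : set (borel M))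
     (fun p : borel M => transported_gradient e P f p i ord0)) /\
  mu.-integrable (X : set (borel M))
    (fun p : borel M => (inner g (gradient f p) (gradient f p))%:E).

Definition G0 (p0 : M) (e : 'I_n -> tangent p0)
    (P : forall p, tangent p -> tangent p0) (mu : probability (borel M) R)
    (X : set M) (f : M -> R) : 'M[R]_n :=
  \matrix_(i, j) \int[mu]_(p in (X : set (borel M)))
    ((transported_gradient e P f p *m (transported_gradient e P f p)^T) i j).

Definition transport_inv (p0 : M) (P : forall p, tangent p -> tangent p0)
    (p : M) : E -> E := 'pinv_(fun=> 0) [set: E] (P p : E -> E).

Definition orthogonal_mx (W : 'M[R]_n) : Prop := W *m W^T = 1%:M.

Definition transported_field (p0 : M) (e : 'I_n -> tangent p0)
    (P : forall p, tangent p -> tangent p0) (W : 'M[R]_n) (i : 'I_n) (p : M) :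
    tangent p :=
  transport_inv P p (of_basis_coord e (col i W)).

End Manifolds.

(* Main.v *)
(* Metric compatibility makes the inner product of two parallel fields constant,
   so each transport [P p] preserves inner products; it is then automatically
   linear and bijective. Hence [df_p(w_i(p)) = <grad f, P^-1 w_i>] equals
   [<P grad f, w_i>], the i-th entry of [W^T u] for [u] the coordinate vector of
   [P grad f]; squaring and integrating gives [(W^T G0 W)_ii = lambda_i]. *)
From HB Require Import structures.
Require Import Defs.
From mathcomp Require Import all_boot all_order all_algebra.
From mathcomp Require Import all_classical all_reals all_analysis.
From mathcomp Require Import measurable_realfun ring lra.

Set Implicit Arguments.
Unset Strict Implicit.
Unset Printing Implicit Defensive.

Import Order.TTheory GRing.Theory Num.Theory.
Import numFieldNormedType.Exports.

Local Open Scope classical_set_scope.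
Local Open Scope ring_scope.

(** * Inner products on tangent spaces: representing functionals, isometries *)

Section Inner.
Context (R : realType) (n : nat) (M : ptopologicalType).
Context (S : smooth_manifold R n M) (g : riemannian_metric S) (p : M).
Local Notation E := 'rV[R]_n.
Implicit Types u v w : E.
Local Notation "<< u , v >>" := (@inner _ _ _ _ g p u v).

Lemma innerDl u v w : << u + v, w >> = << u, w >> + << v, w >>.
Proof. by have := innerDZ g p 1 u v w; rewrite scale1r mul1r. Qed.

Lemma inner0l w : << 0, w >> = 0.
Proof. by apply: (addrI << 0, w >>); rewrite -innerDl !addr0. Qed.

Lemma innerZl a u w : << a *: u, w >> = a * << u, w >>.
Proof. by have := innerDZ g p a u 0 w; rewrite !addr0 inner0l addr0. Qed.

Lemma inner_suml (I : Type) (r : seq I) (Q : pred I) (F : I -> E) w :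
  << \sum_(i <- r | Q i) F i, w >> = \sum_(i <- r | Q i) << F i, w >>.
Proof. by elim/big_rec2: _ => [|i a b _ <-]; rewrite ?inner0l ?innerDl. Qed.

Lemma innerDr u v w : << u, v + w >> = << u, v >> + << u, w >>.
Proof. by rewrite innerC innerDl !(innerC _ u). Qed.

Lemma innerZr a u w : << u, a *: w >> = a * << u, w >>.
Proof. by rewrite innerC innerZl innerC. Qed.

Lemma inner_sumr (I : Type) (r : seq I) (Q : pred I) (F : I -> E) u :
  << u, \sum_(i <- r | Q i) F i >> = \sum_(i <- r | Q i) << u, F i >>.
Proof. by rewrite innerC inner_suml; apply: eq_bigr => i _; exact: innerC. Qed.

Lemma inner_ge0 u : 0 <= << u, u >>.
Proof. by have [->|/(inner_gt0 g p)/ltW//] := eqVneq u 0; rewrite inner0l. Qed.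

Lemma inner_eq0 u : (forall v, << u, v >> = 0) -> u = 0.
Proof.
move=> u0; apply/eqP; apply: contraT => /(inner_gt0 g p).
by rewrite u0 ltxx.
Qed.

(** Finite-dimensional Riesz representation. The Gram matrix [B] of the standard basis is
    invertible, since by definiteness its kernel is trivial; the representing vector is then
    obtained by applying [invmx B] to the values of [phi] on that basis. *)
Lemma inner_surj (phi : E -> R) : scalar phi ->
  exists u, forall v, << u, v >> = phi v.
Proof.
move=> phiP.
pose B : 'M[R]_n :=
  \matrix_(i, j) << delta_mx ord0 i, delta_mx ord0 j >>.
have BE u v : << u, v >> = \sum_j (u *m B) ord0 j * v ord0 j.
  rewrite [in LHS](row_sum_delta v) inner_sumr; apply: eq_bigr => j _.
  rewrite innerZr mulrC [in LHS](row_sum_delta u) inner_suml mxE.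
  by congr (_ * _); apply: eq_bigr => i _; rewrite innerZl mxE.
have Bu : B \in unitmx.
  rewrite -row_free_unit -kermx_eq0; apply/rowV0P => u /sub_kermxP uB.
  apply: inner_eq0 => v; rewrite BE uB.
  by rewrite big1// => j _; rewrite mxE mul0r.
exists ((\row_j phi (delta_mx ord0 j)) *m invmx B) => v.
pose phiL : {linear E -> R^o} :=
  HB.pack phi (GRing.isLinear.Build R E R^o _ phi phiP).
rewrite BE mulmxKV// [in RHS](row_sum_delta v).
rewrite [phi _](linear_sum phiL); apply: eq_bigr => j _.
by rewrite (linearZ_LR phiL) mxE mulrC.
Qed.

End Inner.

Lemma inner_isometry_surj (R : realType) (n : nat) (M : ptopologicalType)
    (S : smooth_manifold R n M) (g : riemannian_metric S) (p q : M)
    (T : 'rV[R]_n -> 'rV[R]_n) :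
  (forall u v, @inner _ _ _ _ g q (T u) (T v) = @inner _ _ _ _ g p u v) ->
  forall w, exists u, T u = w.
Proof.
(* [T] is not assumed linear: with [z := T (a u + v) - (a T u + T v)], [z] is
   orthogonal to the range of [T], hence to itself. *)
move=> Tiso.
have T_linear : linear T.
  move=> a u v; apply/eqP; rewrite -subr_eq0.
  set z := _ - _; apply: contraT => /(inner_gt0 g q).
  suff -> : @inner _ _ _ _ g q z z = 0 by rewrite ltxx.
  have zT x : @inner _ _ _ _ g q z (T x) = 0.
    rewrite /z -scaleN1r innerDl innerZl innerDl innerZl !Tiso innerDl innerZl.
    by rewrite mulN1r subrr.
  rewrite {2}/z -scaleN1r !(innerDr, innerZr) !zT.
  by rewrite !(mulr0, addr0).
pose TL : {linear 'rV[R]_n -> 'rV[R]_n} :=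
  HB.pack T (GRing.isLinear.Build R _ _ _ T T_linear).
have TE u : T u = u *m lin1_mx TL by rewrite mul_rV_lin1.
(* A vector killed by [T] is orthogonal to everything, hence zero; for a square matrix this
   injectivity already gives surjectivity. *)
have Tu : lin1_mx TL \in unitmx.
  rewrite -row_free_unit -kermx_eq0; apply/rowV0P => u /sub_kermxP uT.
  by apply: (@inner_eq0 _ _ _ _ g p) => v; rewrite -Tiso TE uT inner0l.
by move=> w; exists (w *m invmx (lin1_mx TL)); rewrite TE mulmxKV.
Qed.

(** * Charts, coordinate frames and the metric in coordinates *)

Section Frames.
Context (R : realType) (n : nat) (M : ptopologicalType).
Context (S : smooth_manifold R n M).
Local Notation E := 'rV[R]_n.

Lemma overlap_open (c d : chart R n M) : atlas S c -> atlas S d ->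
  open (overlap c d).
Proof.
move=> /atlas_chart cP /atlas_chart dP; rewrite openE => x [p [cp dp] <-].
have px : cimg c (cmap c p) by exists p.
rewrite /interior.
have near_d : \forall y \near cmap c p, cdom d (cinv c y).
  apply: (cinv_continuous cP px).
  by rewrite (cmapK cP cp); apply: open_nbhs_nbhs; split=> //; exact: cdom_open.
have near_c : \forall y \near cmap c p, cimg c y.
  by apply: open_nbhs_nbhs; split=> //; exact: cimg_open.
near=> y.
have : cdom d (cinv c y) by near: y.
have [q cq <-] : cimg c y by near: y.
by rewrite (cmapK cP cq) => dq; exists q.
Unshelve. all: by end_near. Qed.

Lemma transition_differentiable (c d : chart R n M) p :
  atlas S c -> atlas S d -> cdom c p -> cdom d p ->
  differentiable (transition c d) (cmap c p).
Proof.
move=> cA dA cp dp; have [+ _] := atlas_compatible cA dA 1%N.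
by apply; exists p.
Qed.

(** Chain rule: the two transitions compose to the identity on the overlap, which is open, so the
    composite has the derivative of the identity at the point. *)
Lemma diff_transitionK (c d : chart R n M) p (v : E) :
  atlas S c -> atlas S d -> cdom c p -> cdom d p ->
  'd (transition d c) (cmap d p) ('d (transition c d) (cmap c p) v) = v.
Proof.
move=> cA dA cp dp.
have cP := atlas_chart cA; have dP := atlas_chart dA.
have tp : transition c d (cmap c p) = cmap d p by rewrite /transition /= cmapK.
have dcd := transition_differentiable cA dA cp dp.
have ddc := transition_differentiable dA cA dp cp.
rewrite -[LHS]/(('d (transition d c) (cmap d p) \o
  'd (transition c d) (cmap c p)) v) -tp -diff_comp ?tp//.
rewrite -deriveE; last by apply: differentiable_comp; rewrite ?tp.
rewrite (@near_eq_derive _ _ _ _ id) ?derive_id//.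
have : overlap c d (cmap c p) by exists p.
move/(conj (overlap_open cA dA))/open_nbhs_nbhs; apply: filterS.
by move=> _ [q [cq dq] <-] /=; rewrite /transition /= !cmapK.
Qed.

Lemma frame_coord (c : chart R n M) p (v : E) : atlas S c -> cdom c p ->
  v = \sum_i @Defs.coord _ _ _ S c p v ord0 i *: frame S c p i.
Proof.
move=> cA cp; rewrite /frame.
under eq_bigr do rewrite -linearZ.
rewrite -linear_sum -row_sum_delta diff_transitionK//; last exact: chart_at_dom.
exact: chart_at_atlas.
Qed.

(** Vectors are stored in the chart chosen at their own base point; this formula puts all base
    points in [cdom c] into one chart, so that the inner product can be differentiated along a
    curve. *)
Lemma inner_gram (g : riemannian_metric S) (c : chart R n M) p (u v : E) :
  atlas S c -> cdom c p ->
  @inner _ _ _ _ g p u v =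
  \sum_i \sum_j gram S (@inner _ _ _ _ g) c i j (cmap c p)
    * (@Defs.coord _ _ _ S c p u ord0 i * @Defs.coord _ _ _ S c p v ord0 j).
Proof.
move=> cA cp; rewrite [in LHS](frame_coord u cA cp) [in LHS](frame_coord v cA cp).
rewrite inner_suml; apply: eq_bigr => i _.
rewrite inner_sumr; apply: eq_bigr => j _.
rewrite innerZl innerZr /gram (cmapK (atlas_chart cA) cp).
by rewrite mulrA mulrC.
Qed.

End Frames.

(** * Parallel transport and the metric *)

Section ParallelTransport.
Context (R : realType) (n : nat) (M : ptopologicalType).
Context (S : smooth_manifold R n M) (g : riemannian_metric S).
Local Notation E := 'rV[R]_n.

Lemma is_derive_mx_coord (v : R -> E) t k : derivable v t 1 ->
  is_derive t (1 : R) (fun s => v s ord0 k) (derive1 v t ord0 k).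
Proof.
move=> dv; have dvk := (derivable_mxP _ _ _).1 dv ord0 k.
by split; [exact: dvk | rewrite derive1E derive_mx// mxE].
Qed.

Lemma is_derive_comp_pderive (h : E -> R) (x : R -> E) t :
  derivable x t 1 -> differentiable h (x t) ->
  is_derive t (1 : R) (h \o x)
    (\sum_k derive1 x t ord0 k * pderive k h (x t)).
Proof.
move=> /derivable1_diffP dx dh.
have dhx : differentiable (h \o x) t by exact: differentiable_comp.
split; first exact/diff_derivable.
have dx1 : 'd x t 1 = derive1 x t by rewrite derive1E deriveE.
rewrite deriveE// diff_comp//= dx1.
rewrite [X in 'd h _ X](row_sum_delta (derive1 x t)) linear_sum.
by apply: eq_bigr => k _; rewrite linearZ.
Qed.

(* With [A l i = \sum_k x_k Gamma^l_{ki}], metric compatibility says that the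
   Gram matrix [G] evolves by [A^T G + G A] and parallelism that [v' = - A v]. *)
Lemma parallel_product_rule (G : 'I_n -> 'I_n -> R)
    (dG Gam : 'I_n -> 'I_n -> 'I_n -> R)
    (x v w dv dw : 'I_n -> R) :
  (forall i j k, dG k i j = \sum_l (Gam l k i * G l j + Gam l k j * G i l)) ->
  (forall k, dv k = - \sum_i \sum_j Gam k i j * x i * v j) ->
  (forall k, dw k = - \sum_i \sum_j Gam k i j * x i * w j) ->
  \sum_i \sum_j (G i j * (v i * dw j + w j * dv i)
    + v i * w j * \sum_k x k * dG k i j) = 0.
Proof.
move=> dGE dvE dwE.
pose A l i := \sum_k Gam l k i * x k.
have dA (u du : 'I_n -> R) : (forall k, du k = - \sum_i \sum_j Gam k i j * x i * u j) ->
    forall k, du k = - \sum_j A k j * u j.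
  move=> duE k; rewrite duE exchange_big/=; congr (- _).
  by apply: eq_bigr => j _; rewrite mulr_suml.
have dGA i j : \sum_k x k * dG k i j = \sum_l A l i * G l j + \sum_l A l j * G i l.
  under eq_bigr do rewrite dGE mulr_sumr.
  rewrite exchange_big -big_split/=; apply: eq_bigr => l _.
  rewrite /A !mulr_suml -big_split/=; apply: eq_bigr => k _.
  by rewrite mulrDr !mulrA !(mulrC (x k)).
(* The derivative of [w] cancels the summand [G A] of the derivative of [G]; the derivative of [v]
   cancels the summand [A^T G]. *)
have ew : \sum_i \sum_j G i j * (v i * dw j) =
    - \sum_i \sum_j v i * w j * \sum_l A l j * G i l.
  rewrite -sumrN; apply: eq_bigr => i _.
  under eq_bigr do rewrite (dA _ _ dwE) !mulrN !mulr_sumr.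
  rewrite sumrN; congr (- _); rewrite exchange_big/=.
  by apply: eq_bigr => j _; rewrite mulr_sumr; apply: eq_bigr => l _; ring.
have ev : \sum_i \sum_j G i j * (w j * dv i) =
    - \sum_i \sum_j v i * w j * \sum_l A l i * G l j.
  rewrite exchange_big [in RHS]exchange_big -sumrN/=; apply: eq_bigr => j _.
  under eq_bigr do rewrite (dA _ _ dvE) !mulrN !mulr_sumr.
  rewrite sumrN; congr (- _); rewrite exchange_big/=.
  by apply: eq_bigr => i _; rewrite mulr_sumr; apply: eq_bigr => l _; ring.
transitivity (\sum_i \sum_j G i j * (v i * dw j) +
    \sum_i \sum_j G i j * (w j * dv i) +
    (\sum_i \sum_j v i * w j * \sum_l A l i * G l j +
     \sum_i \sum_j v i * w j * \sum_l A l j * G i l)).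
  rewrite -!big_split/=; apply: eq_bigr => i _.
  rewrite -!big_split/=; apply: eq_bigr => j _.
  by rewrite dGA !mulrDr.
by rewrite ev ew; ring.
Qed.

Lemma is_derive_parallel_inner (Gam : christoffel_symbols R n M) (J : set R)
    (gam : R -> M) (V W : forall t, tangent R n (gam t)) :
  metric_compatible g Gam -> C1_curve S J gam ->
  parallel_along S Gam J V -> parallel_along S Gam J W ->
  forall t, J t -> is_derive t (1 : R) (fun s => inner g (V s) (W s)) 0.
Proof.
move=> Gg gamC VP WP t Jt.
have cA := chart_at_atlas S (gam t).
have cp := chart_at_dom S (gam t).
(* The chart is frozen at time [t]: the one chosen at [gam s] may jump with [s]. *)
move: (chart_at S (gam t)) cA cp => c cA cp.
have [gam_cont /(_ c cA cp)[dx _]] := gamC _ Jt.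
have [dv dvE] := VP _ Jt c cA cp.
have [dw dwE] := WP _ Jt c cA cp.
set x := cmap c \o gam in dx dvE dwE.
set v := fun s => Defs.coord S c (V s) in dv dvE.
set w := fun s => Defs.coord S c (W s) in dw dwE.
pose G i j := gram S (@inner _ _ _ _ g) c i j.
have xt : cimg c (x t) by exists (gam t).
have dG i j : differentiable (G i j) (x t).
  by have [+ _] := inner_smooth g i j cA 1%N; apply.
apply: (@near_eq_is_derive _ _ _
  (\sum_i \sum_j (fun s => G i j (x s) * (v s ord0 i * w s ord0 j)))).
  have : \forall s \near t, cdom c (gam s).
    apply: gam_cont; apply: open_nbhs_nbhs; split=> //.
    exact/cdom_open/(atlas_chart cA).
  apply: filterS => s cs; rewrite (inner_gram g _ _ cA cs) fct_sumE.
  by apply: eq_bigr => i _; rewrite fct_sumE.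
apply: is_derive_eq.
  apply: is_derive_sum => i; apply: is_derive_sum => j.
  apply: is_deriveM.
    exact: is_derive_comp_pderive.
  by apply: is_deriveM; apply: is_derive_mx_coord.
apply: (@parallel_product_rule (fun i j => G i j (x t))
  (fun k i j => pderive k (G i j) (x t)) (fun l k i => Gam c l k i (x t))
  (fun k => derive1 x t ord0 k) (fun k => v t ord0 k) (fun k => w t ord0 k)) => //.
by move=> i j k; exact: Gg.
Qed.

Lemma transport_back_isometry (Gam : christoffel_symbols R n M) (gam : R -> M)
    (tau : tangent R n (gam 1) -> tangent R n (gam 0)) :
  metric_compatible g Gam -> C1_curve S `[0, 1] gam ->
  is_transport_back S Gam tau ->
  forall u v, inner g (tau u) (tau v) = inner g u v.
Proof.
move=> Gg gamC tauP u v.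
(* Each parallel field comes with its own margin [e]; restricting to the closed unit interval gives
   a common domain. *)
have sub (e : R) (V : forall t, tangent R n (gam t)) : 0 < e ->
    parallel_along S Gam (around 1 e) V -> parallel_along S Gam `[0, 1] V.
  move=> e0 + t; rewrite /= in_itv/= => VP /andP[t0 t1]; apply: VP.
  by rewrite /around /= in_itv/=; apply/andP; split; lra.
have [V [[eV eV0 /(sub _ _ eV0) VP] <- <-]] := tauP u.
have [W [[eW eW0 /(sub _ _ eW0) WP] <- <-]] := tauP v.
have dF (t : R) : 0 <= t <= 1 ->
    is_derive t (1 : R) (fun s => inner g (V s) (W s)) 0.
  move=> t01; apply: (is_derive_parallel_inner Gg gamC VP WP).
  by rewrite /= in_itv.
(* Zero derivative and the mean value theorem equate the inner products at times 0 and 1. *)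
have [||_ _] := @MVT_segment R (fun s => inner g (V s) (W s)) (fun=> 0) 0 1 ler01.
- by move=> t; rewrite in_itv/= => /andP[t0 t1]; apply: dF; rewrite !ltW.
- apply: derivable_within_continuous => t; rewrite in_itv/= => t01.
  by have [] := dF _ t01.
by rewrite mul0r => /subr0_eq ->.
Qed.

End ParallelTransport.

(** * Measurability of the support *)

Lemma measure_support_closed (R : realType) (T : ptopologicalType)
    (mu : set (borel T) -> \bar R) : closed (measure_support mu).
Proof.
rewrite -openC openE => x /existsNP[U /not_implyP[oU /not_implyP[Ux muU]]].
(* The open set [U] witnessing that [x] is outside the support witnesses the same for each of its
   points. *)
apply: (@filterS _ _ _ U); last exact: open_nbhs_nbhs.
by move=> y Uy /(_ U oU Uy).
Qed.

Lemma measurable_measure_support (R : realType) (T : ptopologicalType)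
    (mu : set (borel T) -> \bar R) :
  measurable (measure_support mu : set (borel T)).
Proof.
rewrite -[measure_support mu]setCK; apply: measurableC.
apply: sub_sigma_algebra; rewrite openC; exact: measure_support_closed.
Qed.

(** * The gradient and Bessel's inequality *)

Section Gradient.
Context (R : realType) (n : nat) (M : ptopologicalType).
Context (S : smooth_manifold R n M) (g : riemannian_metric S).
Local Notation E := 'rV[R]_n.

(** Riesz representation of [dform] guarantees that the choice defining [gradient] does not fall
    back on its default 0. *)
Lemma inner_gradient (f : M -> R) p (v : E) :
  @inner _ _ _ _ g p (gradient g f p) v = @dform _ _ _ S f p v.
Proof.
have dform_scalar : scalar (@dform _ _ _ S f p) by move=> a u w; rewrite /dform linearP.
have [u uP] := inner_surj g p dform_scalar.
exact: (@xgetPex _ 0 [set u : E | forall v : E,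
  @inner _ _ _ _ g p u v = @dform _ _ _ S f p v] (ex_intro _ u uP) v).
Qed.

(** Bessel for one unit vector: [u] minus its projection on [e i] has nonnegative square norm. *)
Lemma inner_orthonormal_le p (e : 'I_n -> E) (u : E) i :
  @orthonormal_basis _ _ _ _ g p e ->
  @inner _ _ _ _ g p u (e i) ^+ 2 <= @inner _ _ _ _ g p u u.
Proof.
move=> /(_ i i); rewrite eqxx mulr1n => eii.
have := inner_ge0 g p (u + (- @inner _ _ _ _ g p u (e i)) *: e i).
rewrite !(innerDl, innerDr, innerZl, innerZr) eii (innerC _ (e i) u).
by rewrite !mulr1 expr2; lra.
Qed.

End Gradient.

(** * Transported eigenvector fields *)

Section TransportedField.
Context (R : realType) (n : nat) (M : ptopologicalType).
Context (S : smooth_manifold R n M) (g : riemannian_metric S) (p0 : M).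
Context (Gam : christoffel_symbols R n M) (X : set M).
Context (P : forall p : M, tangent R n p -> tangent R n p0).
Context (Gg : metric_compatible g Gam) (PP : radial_transport g Gam X P).
Local Notation E := 'rV[R]_n.

Lemma radial_transport_isometry p (u v : E) : X p ->
  @inner _ _ _ _ g p0 (@P p u) (@P p v) =
  @inner _ _ _ _ g p u v.
Proof.
move=> /PP[gam [[[a [a0 gamC _]] _ g0 g1] _] tauP].
have gamC01 : C1_curve S `[0, 1] gam.
  move=> t; rewrite /= in_itv/= => /andP[t0 t1]; apply: gamC.
  by rewrite /around /= in_itv/=; apply/andP; split; lra.
have := transport_back_isometry Gg gamC01 tauP u v.
by rewrite g0 g1.
Qed.

(** The partial inverse ['pinv_] is a right inverse only on the range of [P p]; an isometry between
    spaces of the same dimension has full range. *)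
Lemma transport_invK p (w : E) : X p ->
  @P p (transport_inv P p w) = w.
Proof.
move=> Xp; apply: (@pinvK _ _ (fun=> 0) [set: E] (@P p : E -> E)).
have [u <-] := inner_isometry_surj
  (fun u v => radial_transport_isometry u v Xp) w.
by rewrite inE; exists u.
Qed.

Lemma dform_transported_field (e : 'I_n -> E) (f : M -> R) (W : 'M[R]_n) i p :
  X p ->
  dform S f (@transported_field _ _ _ p0 e P W i p) =
  \sum_j W j i * @transported_gradient _ _ _ _ g p0 e P f p j ord0.
Proof.
move=> Xp; rewrite -(inner_gradient g) -(radial_transport_isometry _ _ Xp).
rewrite /transported_field transport_invK// /of_basis_coord inner_sumr.
by apply: eq_bigr => j _; rewrite innerZr !mxE.
Qed.

End TransportedField.

(** * Integrating the squared derivative and diagonalizing [G0] *)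

Theorem lemma1 (R : realType) (n : nat) (M : ptopologicalType)
    (S : smooth_manifold R n M) (g : riemannian_metric S)
    (Gam : christoffel_symbols R n M) (p0 : M)
    (mu : probability (borel M) R) (f : M -> R)
    (P : forall p : M, tangent R n p -> tangent R n p0)
    (e : 'I_n -> tangent R n p0) (W : 'M[R]_n) (lam : 'rV[R]_n) :
  let X := measure_support mu in
  levi_civita g Gam ->
  wrapped_measure g Gam p0 mu ->
  radial_transport g Gam X P ->
  orthonormal_basis g e ->
  C1_near S X f ->
  square_integrable_gradient g e P mu X f ->
  orthogonal_mx W ->
  G0 g e P mu X f = W *m diag_mx lam *m W^T ->
  (forall i j : 'I_n, (i <= j)%N -> lam ord0 j <= lam ord0 i) ->
  forall i : 'I_n,
    (lam ord0 i)%:E =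
    (\int[mu]_(p in (X : set (borel M)))
       ((dform S f (transported_field e P W i p)) ^+ 2)%:E)%E.
Proof.
move=> X [_ _ Gg] _ PP eP _ [mtg igrad] WW G0E _ i.
have mX : measurable (X : set (borel M)) by exact: measurable_measure_support.
pose tg j (p : borel M) : R := transported_gradient g e P f p j ord0.
(* Domination by the squared norm of the gradient, which transport preserves: Bessel bounds both
   [a ^+ 2] and [b ^+ 2] by it, and the squares of [a + b] and [a - b] then bound [a * b] on both
   sides. *)
have itg j k : mu.-integrable (X : set (borel M)) (fun p => (tg j p * tg k p)%:E).
  apply: le_integrable igrad => //.
    by apply/measurable_EFinP; apply: measurable_funM; exact: mtg.
  move=> p Xp; rewrite !abse_EFin lee_fin.
  rewrite -(radial_transport_isometry Gg PP _ _ Xp).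
  set u := P p (gradient g f p).
  rewrite [leRHS]ger0_norm ?inner_ge0// ler_norml.
  have := inner_orthonormal_le u j eP; have := inner_orthonormal_le u k eP.
  rewrite /tg /transported_gradient !mxE -/u.
  move: (inner g u (e j)) (inner g u (e k)) => a b b2 a2.
  have := sqr_ge0 (a + b); have := sqr_ge0 (a - b).
  by rewrite !expr2 in a2 b2 *; move=> *; apply/andP; split; nra.
transitivity (\int[mu]_(p in (X : set (borel M)))
    (\sum_j \sum_k (W j i * W k i)%:E * (tg j p * tg k p)%:E))%E; last first.
  apply: eq_integral => p; rewrite inE => Xp.
  rewrite (dform_transported_field Gg PP)// expr2 mulr_suml -sumEFin.
  apply: eq_bigr => j _; rewrite mulr_sumr -sumEFin; apply: eq_bigr => k _.
  by rewrite -EFinM /tg mulrACA.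
rewrite integral_sum//; last first.
  by move=> j; apply: integrable_sum => // k _; exact: integrableZl.
under eq_bigr => j _.
  rewrite integral_sum//; last by move=> k; exact: integrableZl.
  under eq_bigr => k _.
    (* Integrability makes the extended-real integral finite, so it can be identified with the real
       entry of [G0]. *)
    rewrite integralZl// -[X in (_ * X)%E]fineK ?integrable_fin_num// -EFinM.
    rewrite (_ : fine _ = G0 g e P mu X f j k); last first.
      by rewrite mxE; apply: eq_Rintegral => p _; rewrite mxE big_ord1 [_^T _ _]mxE.
    over.
  rewrite sumEFin; over.
rewrite sumEFin; congr EFin.
(* The hypothesis gives the right inverse only; diagonalizing needs [W^T] on the left. *)
have WTW : W^T *m W = 1%:M by exact: mulmx1C.
transitivity ((W^T *m G0 g e P mu X f *m W) i i).
  rewrite G0E !mulmxA WTW mul1mx -mulmxA WTW mulmx1.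
  by rewrite mxE eqxx.
rewrite mxE exchange_big/=; apply: eq_bigr => k _; rewrite mxE mulr_suml.
by apply: eq_bigr => j _; rewrite [W^T _ _]mxE mulrAC.
Qed.
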